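(* Let $G=(V_1,E_1)$ be a connected graph with $|V_1|\ge2$ and $H=(V_2,E_2)$ a $\kappa$-regular graph on $n=|V_2|$ vertices, where $n\ge1$ and $\kappa\ge0$. Let $A_H$ be the adjacency matrix of $H$ and, for $\lambda'\in\mathbb{R}$, let \[ \psi_{H*}^{-1}(\lambda')=\frac12\Bigl\{(n+1)\lambda'-(\kappa+2)+\sqrt{((n+1)\lambda'-(\kappa+2))^2+4(\kappa+2)\lambda'}\,\Bigr\}. \] If the following two conditions are satisfied: (i) $-2-\psi_{H*}^{-1}(\mathrm{QEC}(G))\notin\mathrm{ev}(A_H)$; (ii) $\displaystyle -2-\min\mathrm{ev}(A_H)\le-\frac{\kappa+2}{n+1}$; then \[ \mathrm{QEC}(G\odot H)=\psi_{H*}^{-1}(\mathrm{QEC}(G)). \]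
   Context: All graphs are finite, simple and undirected. For a connected graph $G=(V,E)$ with $|V|\ge2$ and distance matrix $D=[d(x,y)]_{x,y\in V}$ (graph distance), $\mathrm{QEC}(G)=\max\{\langle f,Df\rangle\,;\, f\in C(V),\ \langle f,f\rangle=1,\ \langle \mathbf{1},f\rangle=0\}$, where $C(V)$ is the space of real column vectors indexed by $V$ with the canonical inner product and $\mathbf{1}$ is the all-one vector. Corona: for graphs $G=(V_1,E_1)$, $H=(V_2,E_2)$ with $V_1\cap V_2=\emptyset$, $G\odot H$ is obtained from $G$ and $|V_1|$ disjoint copies of $H$ (one for each vertex of $G$) by joining each vertex of $G$ to every vertex of its copy of $H$. $\mathrm{ev}(A_H)$ denotes the set of distinct eigenvalues of $A_H$. The notation $\psi_{H*}^{-1}$ refers to the inverse of the restriction to $(-\frac{\kappa+2}{n+1},+\infty)$ of $\psi_H(\lambda)=\frac{\lambda(\lambda+\kappa+2)}{(n+1)\lambda+\kappa+2}$; it is given explicitly by the formula in the claim. *)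

(* Defs.v *)
From mathcomp Require Import all_boot all_order all_algebra.
From mathcomp Require Import boolp classical_sets reals.

Set Implicit Arguments.
Unset Strict Implicit.
Unset Printing Implicit Defensive.

Import Order.TTheory GRing.Theory Num.Theory.

Local Open Scope ring_scope.

Record sgraph := SGraph {
  vertex :> finType;
  adj : rel vertex;
  adj_sym : symmetric adj;
  adj_irrefl : irreflexive adj }.

Definition connected (G : sgraph) : Prop := forall x y : G, connect (@adj G) x y.

Definition regular (G : sgraph) (k : nat) : Prop :=
  forall x : G, #|[set y : G | adj x y]| = k.

Definition has_walk (G : sgraph) (x y : G) (k : nat) : bool :=
  [exists p : k.-tuple G, path (@adj G) x p && (last x p == y)].

(* The minimum is restricted to k < #|G| without loss: a shortest walk does not
   repeat vertices. The value #|G| is reached only if x and y are not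
   connected. *)
Definition dist (G : sgraph) (x y : G) : nat :=
  \big[minn/#|G|]_(k < #|G| | has_walk x y k) k.

(* Vertex inr (x, h) is the copy of h in the copy of H attached to x. *)
Definition corona_adj (G H : sgraph) : rel (G + G * H)%type := fun u v =>
  match u, v with
  | inl x, inl y => adj x y
  | inl x, inr (y, _) => x == y
  | inr (x, _), inl y => x == y
  | inr (x, h), inr (y, h') => (x == y) && adj h h'
  end.

Lemma corona_sym (G H : sgraph) : symmetric (@corona_adj G H).
Proof.
case=> [x|[x h]] [y|[y h']] /=.
- exact: adj_sym.
- exact: eq_sym.
- exact: eq_sym.
- by rewrite eq_sym adj_sym.
Qed.

Lemma corona_irrefl (G H : sgraph) : irreflexive (@corona_adj G H).
Proof. by move=> [x|[x h]] /=; rewrite adj_irrefl ?andbF. Qed.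

Definition corona (G H : sgraph) : sgraph :=
  SGraph (@corona_sym G H) (@corona_irrefl G H).

(* The default value 0 is returned only when A has no greatest (resp. least)
   element. *)
Definition maximum (R : realType) (A : set R) : R :=
  xget 0 (A `&` ubound A)%classic.

Definition minimum (R : realType) (A : set R) : R :=
  xget 0 (A `&` lbound A)%classic.

Lemma maximumE (R : realType) (A : set R) (m : R) :
  A m -> ubound A m -> maximum A = m.
Proof.
move=> Am ubm; apply: xget_unique => // m' [Am' ubm'].
by apply/eqP; rewrite eq_le ubm //= ubm'.
Qed.

Lemma minimumE (R : realType) (A : set R) (m : R) :
  A m -> lbound A m -> minimum A = m.
Proof.
move=> Am lbm; apply: xget_unique => // m' [Am' lbm'].
by apply/eqP; rewrite eq_le lbm' //= lbm.
Qed.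

(* Vectors and matrices indexed by the vertices of G are indexed by 'I_#|G|
   through the enumeration enum_val of the vertices. *)
Definition dotp (R : realType) (n : nat) (f g : 'cV[R]_n) : R :=
  \sum_i f i 0 * g i 0.

Definition dist_mx (R : realType) (G : sgraph) : 'M[R]_#|G| :=
  \matrix_(i, j) (dist (enum_val i) (enum_val j))%:R.

Definition adj_mx (R : realType) (G : sgraph) : 'M[R]_#|G| :=
  \matrix_(i, j) (adj (enum_val i) (enum_val j))%:R.

Definition QEC (R : realType) (G : sgraph) : R :=
  maximum [set q : R | exists f : 'cV[R]_#|G|,
    [/\ dotp f f = 1, dotp (const_mx 1) f = 0
      & q = dotp f (dist_mx R G *m f)]]%classic.

Definition ev (R : realType) (n : nat) (A : 'M[R]_n) : set R :=
  [set a | eigenvalue A a]%classic.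

Definition psi_inv (R : realType) (n kappa : nat) (l : R) : R :=
  2^-1 * ((n%:R + 1) * l - (kappa%:R + 2)
          + Num.sqrt (((n%:R + 1) * l - (kappa%:R + 2)) ^+ 2
                      + 4 * (kappa%:R + 2) * l)).

(* Main.v *)
From mathcomp Require Import all_boot all_order all_algebra.
From mathcomp Require Import boolp classical_sets reals.
From mathcomp Require Import topology normedtype derive.
From mathcomp Require Import ring lra.
(* Imported last: mathcomp's topology also defines a predicate [connected]. *)
Require Import Defs.

(** Let d be the distance of G, lambda = psi_inv (QEC G), and for a function F on
the corona with zero sum let w(x) be the sum of F over the vertex x of G and its
copy of H, and v_x the restriction of F to this copy.  In the corona, the distance
between two vertices over x and y is d(x,y) plus 1 for each of the two that lies in
a copy, corrected by -(2 I + A_H) inside one copy; hence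
  <F, D F> = <w, D_G w> - \sum_x <v_x, (2 I + A_H) v_x>,
because the "plus 1" terms factor through the sum of F.  Condition (ii) makes
A_H + (lambda + 2) I nonnegative, so that among the v_x with a given sum s constant
functions are optimal, and the inequality <F, D F> <= lambda <F, F> reduces at each
x to QEC(G) w^2 <= lambda (w - s)^2 + (lambda + kappa + 2) s^2 / n.  Since
QEC(G) = psi_H(lambda), the difference of the two sides is a perfect square,
which vanishes for a suitable s; a maximizer w of G then gives one of the corona. *)

Set Implicit Arguments.
Unset Strict Implicit.
Unset Printing Implicit Defensive.

Import Order.TTheory GRing.Theory Num.Theory.
Import numFieldNormedType.Exports.

Local Open Scope ring_scope.

(** * Rayleigh quotients *)

Section Dotp.
Variables (R : realType) (n : nat).
Implicit Types (f g h : 'cV[R]_n) (M : 'M[R]_n).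

Lemma dotpE f g : dotp f g = (f^T *m g) 0 0.
Proof. by rewrite mxE; apply: eq_bigr => i _; rewrite mxE. Qed.

Lemma dotpC f g : dotp f g = dotp g f.
Proof. by apply: eq_bigr => i _; rewrite mulrC. Qed.

Lemma dotpDr f g h : dotp f (g + h) = dotp f g + dotp f h.
Proof. by rewrite !dotpE mulmxDr mxE. Qed.

Lemma dotpZr a f g : dotp f (a *: g) = a * dotp f g.
Proof. by rewrite !dotpE -scalemxAr mxE. Qed.

Lemma dotpDl f g h : dotp (f + g) h = dotp f h + dotp g h.
Proof. by rewrite dotpC dotpDr !(dotpC h). Qed.

Lemma dotpZl a f g : dotp (a *: f) g = a * dotp f g.
Proof. by rewrite dotpC dotpZr dotpC. Qed.

Lemma dotp_sym M f g : M^T = M -> dotp f (M *m g) = dotp (M *m f) g.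
Proof. by move=> symM; rewrite !dotpE trmx_mul symM mulmxA. Qed.

Lemma dotp_ge0 f : 0 <= dotp f f.
Proof. by apply: sumr_ge0 => i _; rewrite -expr2 sqr_ge0. Qed.

Lemma dotp_eq0 f : (dotp f f == 0) = (f == 0).
Proof.
apply/idP/eqP => [/eqP f0|->]; last first.
  by rewrite /dotp big1// => i _; rewrite mxE mul0r.
apply/colP => i; rewrite mxE.
have /psumr_eq0P/(_ f0) : forall j, true -> 0 <= f j 0 * f j 0.
  by move=> j _; rewrite -expr2 sqr_ge0.
by move=> /(_ i isT)/eqP; rewrite mulf_eq0 orbb => /eqP.
Qed.

Lemma dotp_normalize f : dotp f f != 0 ->
  dotp ((Num.sqrt (dotp f f))^-1 *: f) ((Num.sqrt (dotp f f))^-1 *: f) = 1.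
Proof.
move=> f0; rewrite dotpZl dotpZr mulrA -expr2 exprVn sqr_sqrtr ?dotp_ge0//.
by rewrite mulVf.
Qed.

End Dotp.

Section Rayleigh.
Variables (R : realType) (n : nat).
Implicit Types (c v w : 'cV[R]_n) (M : 'M[R]_n).

Lemma tr_coord_continuous (i : 'I_n) :
  continuous (fun v : 'rV[R]_n => (v^T) i 0 : R).
Proof.
have -> : (fun v : 'rV[R]_n => (v^T) i 0 : R) = (fun v : 'rV[R]_n => v 0 i).
  by apply/funext => v; rewrite [LHS]mxE.
exact: coord_continuous.
Qed.

Lemma dotp_continuous (f g : 'rV[R]_n -> 'cV[R]_n) :
  (forall i, continuous (fun v : 'rV[R]_n => f v i 0 : R)) ->
  (forall i, continuous (fun v : 'rV[R]_n => g v i 0 : R)) ->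
  continuous (fun v : 'rV[R]_n => dotp (f v) (g v) : R).
Proof.
move=> cf cg.
apply: continuous_big => [|i _]; first exact: add_continuous.
by move=> v; apply: cvgM; [exact: nbhs_filter|exact: cf|exact: cg].
Qed.

Lemma mulmx_coord_continuous M (i : 'I_n) :
  continuous (fun v : 'rV[R]_n => (M *m v^T) i 0 : R).
Proof.
have -> : (fun v : 'rV[R]_n => (M *m v^T) i 0 : R) =
          (fun v : 'rV[R]_n => \sum_j M i j * (v^T) j 0).
  by apply/funext => v; rewrite [LHS]mxE.
apply: continuous_big => [|j _]; first exact: add_continuous.
move=> v; apply: cvgM; [exact: nbhs_filter|exact: cst_continuous|].
exact: tr_coord_continuous.
Qed.

(** The unit sphere of the hyperplane orthogonal to [c] is compact, so the continuous form attains
    its maximum there; homogeneity extends the bound to the whole hyperplane. *)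
Lemma rayleigh_max M c :
  (exists2 v, dotp v v = 1 & dotp c v = 0) ->
  exists v, [/\ dotp v v = 1, dotp c v = 0 &
    forall w, dotp c w = 0 -> dotp w (M *m w) <= dotp v (M *m v) * dotp w w].
Proof.
move=> [v0 v01 cv0].
pose A := [set v : 'rV[R]_n | dotp v^T v^T = 1 /\ dotp c v^T = 0]%classic.
have A0 : (A !=set0)%classic by exists v0^T; rewrite /A/= trmxK.
have Acl : closed A.
  apply: closedI.
    apply: (preimage_closed _ (@closed_eq _ _)) => v _.
    by apply: dotp_continuous => i; exact: tr_coord_continuous.
  apply: (preimage_closed _ (@closed_eq _ _)) => v _.
  apply: dotp_continuous => i; last exact: tr_coord_continuous.
  exact: cst_continuous.
have Abd : bounded_set A.
  exists 1; split => [|x x1 v [v1 _]]; first exact: num_real.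
  apply: le_trans (ltW x1).
  (* The norm is the sup norm: the square of each entry is at most the sum of all squares, which is
     1. *)
  rewrite [`|v|]mx_normrE; apply/bigmax_leP; split => //= -[i j] _ /=.
  rewrite -(@expr_le1 _ 2)// real_normK ?num_real// -v1 ord1.
  rewrite /dotp (bigD1 j)//= !mxE -expr2 lerDl.
  by apply: sumr_ge0 => k _; rewrite -expr2 sqr_ge0.
have cf : continuous (fun v : 'rV[R]_n => dotp v^T (M *m v^T) : R).
  apply: dotp_continuous => i; first exact: tr_coord_continuous.
  exact: mulmx_coord_continuous.
have [v] := EVT_max_rV A0 (bounded_closed_compact Abd Acl)
  (continuous_subspaceT cf).
rewrite inE => -[v1 cv] vmax; exists v^T; split => // w cw.
have [->|w0] := eqVneq w 0.
  by rewrite mulmx0 (_ : dotp 0 0 = 0) ?mulr0//; apply/eqP; rewrite dotp_eq0.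
have ww : dotp w w != 0 by rewrite dotp_eq0.
set a := (Num.sqrt (dotp w w))^-1.
have /vmax : (a *: w)^T \in A.
  by rewrite inE /A/= trmxK dotp_normalize// dotpZr cw mulr0.
rewrite trmxK -scalemxAr dotpZl dotpZr mulrA -expr2 exprVn.
rewrite sqr_sqrtr ?dotp_ge0// ler_pdivrMl 1?[leRHS]mulrC//.
by rewrite lt_def ww dotp_ge0.
Qed.

(** A minimizer of the Rayleigh quotient is an eigenvector, because its residual [M v - mu v] is
    forced to vanish. *)
Lemma rayleigh_min_eigenvalue M : (0 < n)%N -> M^T = M ->
  exists2 mu, eigenvalue M mu & forall w, mu * dotp w w <= dotp w (M *m w).
Proof.
move=> n0 symM.
(* The constraint vector 0 is void, so maximizing [- M] minimizes [M] over the whole unit sphere. *)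
have [|v [v1 _ vmax]] := @rayleigh_max (- M) 0.
  exists (delta_mx (Ordinal n0) 0); last first.
    by rewrite dotpE trmx0 mul0mx mxE.
  by rewrite dotpE trmx_delta mul_delta_mx mxE !eqxx.
have dN w : dotp w (- M *m w) = - dotp w (M *m w).
  by rewrite mulNmx -scaleN1r dotpZr mulN1r.
set mu := dotp v (M *m v).
have Mge w : mu * dotp w w <= dotp w (M *m w).
  have := vmax w; rewrite !dN mulNr lerN2; apply.
  by rewrite dotpE trmx0 mul0mx mxE.
exists mu => //.
have [r Mv] : exists r, M *m v = r + mu *: v.
  by exists (M *m v - mu *: v); rewrite subrK.
pose b := dotp r r.
pose p := dotp r (M *m r) - mu * dotp r r.
have p_ge0 : 0 <= p by rewrite subr_ge0.
(* The nonnegative form w |-> <w, M w> - mu <w, w> vanishes at v, so its first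
   variation at v in the direction of the residual r vanishes too. *)
have quad t : 0 <= 2 * t * b + t ^+ 2 * p.
  have := Mge (v + t *: r); rewrite -subr_ge0; congr (0 <= _).
  rewrite mulmxDr -scalemxAr !(dotpDl, dotpDr, dotpZl, dotpZr).
  rewrite [dotp v (M *m r)](dotp_sym _ _ symM) [dotp r (M *m v)]dotpC.
  (* Both [M v] and [mu v] have inner product [mu] with the unit vector [v]. *)
  have vr : dotp v r = 0.
    apply: (addIr mu); rewrite add0r -[X in _ + X]mulr1 -v1 -dotpZr -dotpDr.
    by rewrite -Mv.
  by rewrite -/mu Mv /p /b !(dotpDl, dotpDr, dotpZl, dotpZr) (dotpC r v) vr v1; ring.
have /eqP : b = 0.
  apply/eqP/negPn/negP => b0.
  have {b0}b_gt0 : 0 < b by rewrite lt_def b0 dotp_ge0.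
  (* The quadratic is least at [- b / p]; the denominator [p + 1] also covers [p = 0] and still
     gives a negative value. *)
  have := quad (- (b / (p + 1))).
  have p1 : 0 < p + 1 by rewrite ltr_wpDl.
  have -> : 2 * - (b / (p + 1)) * b + (- (b / (p + 1))) ^+ 2 * p =
            - ((b / (p + 1)) ^+ 2 * (p + 2)).
    by field; rewrite gt_eqF.
  by rewrite oppr_ge0 leNgt mulr_gt0// ?exprn_gt0 ?divr_gt0// ltr_wpDl.
rewrite dotp_eq0 => /eqP r0; rewrite r0 add0r in Mv.
apply/eigenvalueP; exists v^T.
  by rewrite -{1}symM -trmx_mul Mv linearZ.
apply: contraTneq (oner_neq0 R) => /(congr1 trmx); rewrite trmxK trmx0 => v0.
by rewrite -v1 negbK dotp_eq0 v0.
Qed.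

(** The eigenvalue [mu] that bounds the form from below is the least one, as testing the bound on
    any eigenvector shows; so [minimum] does not take its default value. *)
Lemma minimum_ev_le M : (0 < n)%N -> M^T = M ->
  forall w, minimum (ev M) * dotp w w <= dotp w (M *m w).
Proof.
move=> n0 symM; have [mu evmu mule] := rayleigh_min_eigenvalue n0 symM.
rewrite (minimumE evmu)// => a /eigenvalueP[v va v0].
have vv : 0 < dotp v^T v^T.
  by rewrite lt_def dotp_ge0 dotp_eq0 andbT -(inj_eq (@trmx_inj _ _ _)) trmxK trmx0.
by rewrite -(ler_pM2r vv) (le_trans (mule _))// -{1}symM -trmx_mul va linearZ dotpZr.
Qed.

End Rayleigh.

(** * Distances in the corona *)

Section Walks.
Variable G : sgraph.
Implicit Types (x y z : G) (j k : nat).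

Lemma has_walkP x y k :
  reflect (exists p, [/\ path (@adj G) x p, last x p = y & size p = k])
          (has_walk x y k).
Proof.
apply: (iffP existsP) => [[p /andP[xp /eqP yp]]|[p [xp yp sp]]].
  by exists p; rewrite size_tuple.
by exists (Tuple (introT eqP sp)); rewrite /= xp yp eqxx.
Qed.

Lemma has_walk0 x : has_walk x x 0.
Proof. by apply/has_walkP; exists [::]. Qed.

Lemma has_walk1 x y : adj x y -> has_walk x y 1.
Proof. by move=> xy; apply/has_walkP; exists [:: y]; rewrite /= xy. Qed.

Lemma has_walk_cat x y z j k :
  has_walk x y j -> has_walk y z k -> has_walk x z (j + k).
Proof.
move=> /has_walkP[p [xp yp <-]] /has_walkP[q [yq zq <-]].
apply/has_walkP; exists (p ++ q).
by rewrite cat_path xp yp yq last_cat yp zq size_cat.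
Qed.

(** Cutting out cycles brings the length below [#|G|], into the range of the minimum that defines
    [dist]. *)
Lemma has_walk_short x y k : has_walk x y k ->
  exists2 j, has_walk x y j & (j <= k)%N && (j < #|G|)%N.
Proof.
move=> /has_walkP[p [xp yp <-]]; case/shortenP: xp yp => q xq uq qp yq.
exists (size q); first by apply/has_walkP; exists q.
rewrite (uniq_leq_size (subseq_uniq (subseq_cons _ _) uq) qp)/=.
by rewrite -ltnS -[(size q).+1]/(size (x :: q)) ltnS -(card_uniqP uq) max_card.
Qed.

Lemma dist_le x y k : has_walk x y k -> (dist x y <= k)%N.
Proof.
move=> /has_walk_short[j xyj /andP[jk jG]]; apply: leq_trans jk.
exact: (@bigmin_le_cond _ _ _ _ (Ordinal jG) _ (fun i => i : nat)).
Qed.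

Lemma dist_eq x y k : has_walk x y k ->
  (forall j, has_walk x y j -> (k <= j)%N) -> dist x y = k.
Proof.
move=> xyk kmin; apply/eqP; rewrite eqn_leq dist_le//=.
rewrite /dist; elim/big_ind: _ => [|a b|i xyi].
(* The default [#|G|] of the minimum is also at least [k], since some walk is shorter than
   [#|G|]. *)
- have [j /kmin kj /andP[_ jG]] := has_walk_short xyk.
  by rewrite (leq_trans kj)// ltnW.
- by rewrite leq_min => -> ->.
- exact: kmin.
Qed.

Lemma has_walk_dist x y : connected G -> has_walk x y (dist x y).
Proof.
move=> Gconn; have /connectP[p xp yp] := Gconn x y.
have ex : exists k, has_walk x y k.
  by exists (size p); apply/has_walkP; exists p.
case: (ex_minnP ex) => k xyk kmin; by rewrite (dist_eq xyk kmin).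
Qed.

Lemma dist_refl x : dist x x = 0%N.
Proof. exact/dist_eq/(fun _ _ => leq0n _)/has_walk0. Qed.

Lemma dist_adj x y z : connected G -> adj x y -> (dist x z <= (dist y z).+1)%N.
Proof.
move=> Gconn xy; apply: dist_le; rewrite -add1n.
exact: has_walk_cat (has_walk1 xy) (has_walk_dist _ _ Gconn).
Qed.

(** Each step of a walk lowers the distance to the endpoint by at most one. This gives lower bounds
    on distances without analysing the shape of walks. *)
Lemma walk_potential (d : G -> G -> nat) :
  (forall x, d x x = 0%N) ->
  (forall x y z, adj x y -> (d x z <= (d y z).+1)%N) ->
  forall x y k, has_walk x y k -> (d x y <= k)%N.
Proof.
move=> d0 dadj x y k /has_walkP[p [xp yp <-]].
elim: p x xp yp => /= [x _ ->|z p IH x /andP[xz zp] yp]; first by rewrite d0.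
by rewrite (leq_trans (dadj _ _ _ xz))// ltnS IH.
Qed.

End Walks.

Section CoronaDist.
Variables (G H : sgraph).
Hypothesis Gconn : connected G.

Definition corona_dist (a b : corona G H) : nat :=
  match a, b with
  | inl x, inl y => dist x y
  | inl x, inr (y, _) | inr (x, _), inl y => (dist x y).+1
  | inr (x, h), inr (y, h') =>
      if x == y then if h == h' then 0 else if adj h h' then 1 else 2
      else (dist x y).+2
  end%N.

Lemma has_walk_corona_inl (x y : G) k :
  has_walk x y k -> has_walk (inl x : corona G H) (inl y) k.
Proof.
move=> /has_walkP[p [xp yp <-]]; apply/has_walkP; exists (map inl p).
by rewrite size_map last_map yp; split=> //; rewrite path_map.
Qed.

(** The lower bound holds because [corona_dist] is a potential; the upper bound comes from explicit
    walks that leave and enter copies through their base vertices. *)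
Lemma dist_corona (a b : corona G H) : dist a b = corona_dist a b.
Proof.
apply: dist_eq; last first.
  apply: walk_potential => [[x|[x h]]|].
  - exact: dist_refl.
  - by rewrite /= !eqxx.
  move=> [x|[x h]] [y|[y h']] [z|[z h'']] /=
    => [xy|xy|/eqP<-|/eqP<-|/eqP<-|/eqP<-|/andP[/eqP<- hh']|/andP[/eqP<- hh']].
  - exact: dist_adj.
  - by rewrite ltnS dist_adj.
  - by rewrite ltnW.
  - by case: eqVneq => [->|_]; rewrite ?dist_refl ?leqnSn// ltnW.
  - by [].
  - by case: eqVneq => // _; case: ifP => // _; case: ifP.
  - by [].
  (* Distance 2 on the left could only exceed the bound if [h' = h''], but then [h] and [h''] are
     adjacent. *)
  - case: eqVneq => // _; case: eqVneq => // hh''.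
    case: ifP => // nadj; case: eqVneq => [h'h''|]; last by case: ifP.
    by rewrite -h'h'' hh' in nadj.
have inlr (x : G) h : has_walk (inl x : corona G H) (inr (x, h)) 1.
  by apply: has_walk1 => /=.
have inrl (x : G) h : has_walk (inr (x, h) : corona G H) (inl x) 1.
  by apply: has_walk1 => /=.
have inll (x y : G) : has_walk (inl x : corona G H) (inl y) (dist x y).
  by apply: has_walk_corona_inl; exact: has_walk_dist.
case: a b => [x|[x h]] [y|[y h']] /=.
- exact: inll.
- by rewrite -addn1; apply: has_walk_cat (inll _ _) (inlr _ _).
- by rewrite -add1n; apply: has_walk_cat (inrl _ _) (inll _ _).
- case: eqVneq => [<-|_]; last first.
    have -> : (dist x y).+2 = (1 + (dist x y + 1))%N by rewrite addn1.
    exact: has_walk_cat (inrl _ _) (has_walk_cat (inll _ _) (inlr _ _)).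
  case: eqVneq => [<-|_]; first exact: has_walk0.
  case: ifP => [hh'|_]; first by apply: has_walk1; rewrite /= eqxx.
  exact: has_walk_cat (inrl _ _) (inlr _ _).
Qed.

End CoronaDist.

(** * Quadratic forms *)

Definition quad (R : realType) (T : finType) (M : T -> T -> R) (F : T -> R) : R :=
  \sum_x \sum_y M x y * (F x * F y).

Definition dist_form (R : realType) (G : sgraph) (F : G -> R) : R :=
  quad (fun x y => (dist x y)%:R) F.

Section Forms.
Variables (R : realType) (T : finType).
Implicit Types (M N : T -> T -> R) (F K : T -> R).

Lemma sum_enum_val F : \sum_(i < #|T|) F (enum_val i) = \sum_x F x.
Proof. rewrite [RHS](reindex (fun i : 'I_#|T| => enum_val i))//.
exact/onW_bij/enum_val_bij. Qed.

Lemma dotp_col F K :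
  dotp (\col_(i < #|T|) F (enum_val i)) (\col_(i < #|T|) K (enum_val i)) =
  \sum_x F x * K x.
Proof. by rewrite -sum_enum_val; apply: eq_bigr => i _; rewrite !mxE. Qed.

Lemma dotp_mulmx_col M F :
  dotp (\col_(i < #|T|) F (enum_val i))
       ((\matrix_(i < #|T|, j < #|T|) M (enum_val i) (enum_val j)) *m
        \col_(i < #|T|) F (enum_val i)) = quad M F.
Proof.
rewrite /quad -sum_enum_val; apply: eq_bigr => i _.
rewrite !mxE mulr_sumr -sum_enum_val; apply: eq_bigr => j _.
by rewrite !mxE mulrCA.
Qed.

Lemma col_enum_valP (f : 'cV[R]_#|T|) :
  exists F, f = \col_(i < #|T|) F (enum_val i).
Proof.
by exists (fun x => f (enum_rank x) 0); apply/colP => i; rewrite mxE enum_valK.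
Qed.

Lemma quadB M N F : quad (fun x y => M x y - N x y) F = quad M F - quad N F.
Proof.
rewrite /quad -sumrB; apply: eq_bigr => x _.
by rewrite -sumrB; apply: eq_bigr => y _; rewrite mulrBl.
Qed.

Lemma eq_quad M N F : (forall x y, M x y = N x y) -> quad M F = quad N F.
Proof. by move=> MN; do 2!apply: eq_bigr => ? _; rewrite MN. Qed.

End Forms.

(** * Attainment and characterization of QEC *)

Section QECTheory.
Variables (R : realType) (G : sgraph).
Implicit Types F K : G -> R.

Lemma sum_col F :
  dotp (const_mx 1) (\col_(i < #|G|) F (enum_val i)) = \sum_x F x.
Proof.
by rewrite -sum_enum_val; apply: eq_bigr => i _; rewrite !mxE mul1r.
Qed.

Lemma norm_col F :
  dotp (\col_(i < #|G|) F (enum_val i)) (\col_(i < #|G|) F (enum_val i)) =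
  \sum_x F x ^+ 2.
Proof. by rewrite dotp_col; apply: eq_bigr => x _; rewrite expr2. Qed.

Lemma dist_form_col F :
  dotp (\col_(i < #|G|) F (enum_val i))
       (dist_mx R G *m \col_(i < #|G|) F (enum_val i)) = dist_form F.
Proof. exact: (dotp_mulmx_col (fun x y : G => (dist x y)%:R)). Qed.

(** Two distinct vertices provide a nonzero vector of zero sum, so compactness applies and [QEC] is
    a true maximum. *)
Lemma QEC_attained : (1 < #|G|)%N -> exists F,
  [/\ \sum_x F x ^+ 2 = 1, \sum_x F x = 0, dist_form F = QEC R G &
   forall K, \sum_x K x = 0 -> dist_form K <= QEC R G * \sum_x K x ^+ 2].
Proof.
move=> /card_gt1P[x [y [_ _ xy]]].
have [|f [f1 cf fmax]] := @rayleigh_max R _ (dist_mx R G) (const_mx 1).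
  pose K z : R := (z == x)%:R - (z == y)%:R.
  pose f : 'cV[R]_#|G| := \col_(i < #|G|) K (enum_val i).
  have ff : dotp f f != 0.
    rewrite dotp_eq0; apply/eqP => /colP/(_ (enum_rank x)).
    by rewrite !mxE enum_rankK /K eqxx (negbTE xy) subr0 => /eqP; rewrite oner_eq0.
  exists ((Num.sqrt (dotp f f))^-1 *: f); first exact: dotp_normalize.
  rewrite dotpZr sum_col sumrB; have s1 z : \sum_w (w == z)%:R = 1 :> R.
    by rewrite (bigD1 z)//= eqxx big1 ?addr0// => w /negbTE ->.
  by rewrite !s1 subrr mulr0.
have QECf : QEC R G = dotp f (dist_mx R G *m f).
  apply: maximumE => [|q [w [w1 cw ->]]]; first by exists f.
  by have := fmax _ cw; rewrite w1 mulr1.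
move: f1 cf fmax QECf; have [F ->] := col_enum_valP f.
rewrite norm_col sum_col dist_form_col => f1 cf fmax QECf.
exists F; split => // K sK.
have := fmax (\col_(i < #|G|) K (enum_val i)).
by rewrite sum_col norm_col dist_form_col QECf => /(_ sK).
Qed.

(** The witness [F] may have any nonzero norm, since both sides of the equality scale
    quadratically. *)
Lemma QEC_eq (m : R) F : \sum_x F x ^+ 2 != 0 -> \sum_x F x = 0 ->
  dist_form F = m * \sum_x F x ^+ 2 ->
  (forall K, \sum_x K x = 0 -> dist_form K <= m * \sum_x K x ^+ 2) ->
  QEC R G = m.
Proof.
move=> F0 sF qF ub; apply: maximumE => [|q [w [w1 cw ->]]]; last first.
  move: w1 cw; have [K ->] := col_enum_valP w.
  rewrite norm_col sum_col dist_form_col.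
  by move=> w1 /ub; rewrite w1 mulr1.
pose f : 'cV[R]_#|G| := \col_(i < #|G|) F (enum_val i).
exists ((Num.sqrt (dotp f f))^-1 *: f); split.
- by rewrite dotp_normalize// norm_col.
- by rewrite dotpZr sum_col sF mulr0.
- rewrite -scalemxAr dotpZl dotpZr mulrA -expr2 exprVn sqr_sqrtr ?dotp_ge0//.
  by rewrite dist_form_col norm_col qF mulrCA mulVf// mulr1.
Qed.

End QECTheory.

(** * The distance form of the corona *)

Section CoronaForm.
Variables (R : realType) (G H : sgraph).
Hypothesis Gconn : connected G.
Variable F : corona G H -> R.

Definition base (a : corona G H) : G :=
  match a with inl x => x | inr (x, _) => x end.

Definition is_copy (a : corona G H) : R := if a is inr _ then 1 else 0.

Definition copy_form (a b : corona G H) : R :=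
  match a, b with
  | inr (x, h), inr (y, h') => (x == y)%:R * (2 * (h == h')%:R + (adj h h')%:R)
  | _, _ => 0
  end.

(** Inside one copy the base distance is 0 and the two indicators add up to 2; subtracting 2, 1 or 0
    leaves the distance of equal, adjacent or other vertices. *)
Lemma dist_coronaE (a b : corona G H) :
  (dist a b)%:R =
  (dist (base a) (base b))%:R + is_copy a + is_copy b - copy_form a b :> R.
Proof.
rewrite dist_corona//; case: a b => [x|[x h]] [y|[y h']] /=.
- by rewrite !addr0 subr0.
- by rewrite subr0 addr0 -natr1.
- by rewrite subr0 addr0 -natr1.
- case: eqVneq => [->|_]; last by rewrite mul0r subr0 -!natr1.
  rewrite dist_refl; case: eqVneq => [->|hh'].
    by rewrite adj_irrefl ?mulr1n ?mulr0n; ring.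
  by case: ifP => _; rewrite ?mulr1n ?mulr0n; ring.
Qed.

Lemma big_corona (f : corona G H -> R) :
  \sum_a f a = \sum_x (f (inl x) + \sum_h f (inr (x, h))).
Proof.
rewrite big_sumType big_split/=; congr (_ + _).
by rewrite (pair_big xpredT xpredT (fun x h => f (inr (x, h))))/=;
  apply: eq_bigr => -[].
Qed.

Definition fibre_sum (x : G) : R := F (inl x) + \sum_h F (inr (x, h)).

Lemma quad_base (M : G -> G -> R) :
  quad (fun a b => M (base a) (base b)) F = quad M fibre_sum.
Proof.
have inner (a : corona G H) :
    \sum_b M (base a) (base b) * (F a * F b) =
    F a * \sum_y M (base a) y * fibre_sum y.
  rewrite big_corona mulr_sumr; apply: eq_bigr => y _ /=.
  rewrite -mulr_sumr -mulr_sumr -!mulrDr; exact: mulrCA.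
rewrite /quad (eq_bigr _ (fun a _ => inner a)) big_corona.
apply: eq_bigr => x _ /=.
rewrite -mulr_suml -mulrDl mulr_sumr; apply: eq_bigr => y _; exact: mulrCA.
Qed.

Lemma dist_form_corona : \sum_a F a = 0 ->
  dist_form F = dist_form fibre_sum -
    \sum_x (2 * \sum_h F (inr (x, h)) ^+ 2
            + quad (fun h h' => (adj h h')%:R) (fun h => F (inr (x, h)))).
Proof.
move=> sF; rewrite /dist_form (eq_quad _ dist_coronaE) quadB; congr (_ - _).
  rewrite -quad_base /quad; under eq_bigr do under eq_bigr do rewrite -addrA mulrDl.
  under eq_bigr do rewrite big_split/=.
  rewrite big_split/= [X in _ + X](_ : _ = 0) ?addr0//.
  (* Each indicator depends on one variable only, so summing over the other produces the factor
     [\sum_a F a = 0]. *)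
  transitivity (\sum_a (is_copy a * F a * (\sum_b F b) +
                        F a * \sum_b is_copy b * F b)).
    apply: eq_bigr => a _; rewrite !mulr_sumr -big_split.
    by apply: eq_bigr => b _ /=; ring.
  by rewrite big_split/= -!mulr_suml sF mulr0 mul0r addr0.
rewrite /quad big_corona; apply: eq_bigr => x _.
rewrite big1 ?add0r => [|b _]; last by rewrite mul0r.
rewrite mulr_sumr -big_split; apply: eq_bigr => h _ /=.
rewrite big_corona (bigD1 x)//= [X in _ + X]big1 => [|y xy]; last first.
  rewrite mul0r add0r big1// => h' _.
  by rewrite eq_sym (negbTE xy) !mul0r.
rewrite mul0r add0r addr0.
under eq_bigr do rewrite eqxx mul1r mulrDl.
rewrite big_split/=; congr (_ + _).
rewrite (bigD1 h)//= big1 ?addr0 => [|h' hh'].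
  by rewrite eqxx mulr1 expr2.
by rewrite eq_sym (negbTE hh') mulr0 mul0r.
Qed.

End CoronaForm.

(** * The adjacency form of a regular graph *)

Section Regular.
Variables (R : realType) (H : sgraph) (kappa : nat).
Hypotheses (H_regular : regular H kappa) (H_gt0 : (0 < #|H|)%N).
Local Notation n := (#|H|%:R : R).
Local Notation adj_form := (quad (fun h h' : H => (adj h h')%:R : R)).
Implicit Types v : H -> R.

Lemma sum_adj (h : H) : \sum_h' (adj h h')%:R = kappa%:R :> R.
Proof.
rewrite -(H_regular h) -sum1_card natr_sum [LHS]big_mkcond [RHS]big_mkcond/=.
by apply: eq_bigr => h' _; rewrite inE; case: adj.
Qed.

Lemma adj_form_const (a : R) : adj_form (fun=> a) = kappa%:R * n * a ^+ 2.
Proof.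
rewrite /quad; under eq_bigr do rewrite -mulr_suml sum_adj.
by rewrite sumr_const -mulr_natl; ring.
Qed.

(** By regularity the constants are eigenvectors for [kappa], so the cross terms with the zero-sum
    deviation vanish. *)
Lemma adj_form_mean v (a := (\sum_h v h) / n) :
  adj_form v = adj_form (fun h => v h - a) + kappa%:R * n * a ^+ 2.
Proof.
have n0 : n != 0 by rewrite pnatr_eq0 -lt0n.
pose z h := v h - a.
have sz : \sum_h z h = 0.
  rewrite sumrB sumr_const -mulr_natr /a -mulrA mulVf// mulr1 subrr//.
have sum_adjr (h' : H) : \sum_(h : H) (adj h h')%:R = kappa%:R :> R.
  by rewrite -(sum_adj h'); apply: eq_bigr => h _; rewrite adj_sym.
have cross : \sum_(h : H) \sum_(h' : H) (adj h h')%:R * z h' = 0 :> R.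
  rewrite exchange_big/=; under eq_bigr do rewrite -mulr_suml sum_adjr.
  by rewrite -mulr_sumr sz mulr0.
have cross' : \sum_(h : H) \sum_(h' : H) (adj h h')%:R * z h = 0 :> R.
  under eq_bigr do rewrite -mulr_suml sum_adj.
  by rewrite -mulr_sumr sz mulr0.
transitivity (adj_form z + adj_form (fun=> a) +
  a * (\sum_(h : H) \sum_(h' : H) (adj h h')%:R * z h') +
  a * (\sum_(h : H) \sum_(h' : H) (adj h h')%:R * z h)); last first.
  by rewrite cross cross' !mulr0 !addr0 adj_form_const.
rewrite !mulr_sumr -!big_split; apply: eq_bigr => h _ /=.
rewrite !mulr_sumr -!big_split; apply: eq_bigr => h' _ /=.
by rewrite /z; ring.
Qed.

Lemma sum_sqr_mean v (a := (\sum_h v h) / n) :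
  \sum_h v h ^+ 2 = \sum_h (v h - a) ^+ 2 + n * a ^+ 2.
Proof.
have n0 : n != 0 by rewrite pnatr_eq0 -lt0n.
transitivity (\sum_h ((v h - a) ^+ 2 + 2 * a * v h - a ^+ 2)).
  by apply: eq_bigr => h _; ring.
rewrite sumrB big_split/= -mulr_sumr sumr_const -mulr_natl.
have -> : \sum_h v h = n * a by rewrite /a mulrC divfK.
by ring.
Qed.

Lemma adj_form_ge v :
  minimum (ev (adj_mx R H)) * \sum_h v h ^+ 2 <= adj_form v.
Proof.
have symA : (adj_mx R H)^T = adj_mx R H.
  by apply/matrixP => i j; rewrite !mxE adj_sym.
have := minimum_ev_le H_gt0 symA (\col_(i < #|H|) v (enum_val i)).
by rewrite (dotp_mulmx_col (fun h h' : H => (adj h h')%:R)) norm_col.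
Qed.

(* Splitting v into its mean and its deviation z, the deviation contributes at
   least (mu + l + 2) |z|^2 >= 0 and the mean exactly the left-hand side. *)
Lemma adj_form_shift_ge (l : R) v :
  0 <= l + 2 + minimum (ev (adj_mx R H)) ->
  (l + 2 + kappa%:R) * (\sum_h v h) ^+ 2 / n <=
  (l + 2) * (\sum_h v h ^+ 2) + adj_form v.
Proof.
move=> l0; have n0 : n != 0 by rewrite pnatr_eq0 -lt0n.
rewrite adj_form_mean sum_sqr_mean; set a := (\sum_h v h) / n.
have -> : \sum_h v h = n * a by rewrite /a mulrC divfK.
have -> : (l + 2 + kappa%:R) * (n * a) ^+ 2 / n =
  (l + 2) * (n * a ^+ 2) + kappa%:R * n * a ^+ 2 by field.
rewrite mulrDr.
have := adj_form_ge (fun h => v h - a).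
have : 0 <= \sum_h (v h - a) ^+ 2 by apply: sumr_ge0 => h _; rewrite sqr_ge0.
move: (minimum _) (\sum_h (v h - a) ^+ 2) (quad _ _) l0 => mu s q l0 s0 sq.
by have := mulr_ge0 l0 s0; nra.
Qed.

End Regular.

(** * The inverse of psi_H as a root of a quadratic *)

Section PsiInv.
Variables (R : realType) (n kappa : nat) (q : R).
Hypothesis n_gt0 : (0 < n)%N.
Let l := psi_inv n kappa q.
Let B := (n%:R + 1) * q - (kappa%:R + 2).
Let D := B ^+ 2 + 4 * (kappa%:R + 2) * q.
Let t : R := (kappa%:R + 2) / (n%:R + 1).

Let n1 : n%:R + 1 != 0 :> R.
Proof. by rewrite natr1 pnatr_eq0. Qed.

Let kt : kappa%:R + 2 = t * (n%:R + 1).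
Proof. by rewrite divfK. Qed.

(* l^2 - B l - (kappa + 2) q, with discriminant D and larger root l, is negative
   at -t. *)
Let discr_gt : (2 * t + B) ^+ 2 < D.
Proof.
rewrite -subr_gt0 /D /B kt.
have -> : ((n%:R + 1) * q - t * (n%:R + 1)) ^+ 2 + 4 * (t * (n%:R + 1)) * q -
  (2 * t + ((n%:R + 1) * q - t * (n%:R + 1))) ^+ 2 = 4 * n%:R * t ^+ 2 by ring.
have t0 : 0 < t by rewrite divr_gt0 ?natr1 -?natrD ?ltr0n// addn2.
by rewrite mulr_gt0 ?exprn_gt0// mulr_gt0 ?ltr0n.
Qed.

(** By [discr_gt] the larger root [l] lies to the right of [- t], the pole of psi_H. *)
Lemma psi_inv_gt : 0 < (n%:R + 1) * l + kappa%:R + 2.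
Proof.
have lt2 : - (2 * t + B) < Num.sqrt D.
  apply: le_lt_trans (ler_norm _) _; rewrite normrN -sqrtr_sqr ltr_sqrt//.
  exact: le_lt_trans (sqr_ge0 _) discr_gt.
have -> : (n%:R + 1) * l + kappa%:R + 2 =
  (n%:R + 1) * (2^-1 * (2 * t + B + Num.sqrt D)).
  by rewrite -addrA kt /l /psi_inv -/B -/D; field.
rewrite mulr_gt0 ?natr1 ?ltr0n// mulr_gt0 ?invr_gt0 ?ltr0n//.
by move: lt2; rewrite -subr_gt0 opprK addrC.
Qed.

(** This is psi_H(l) = q cleared of its denominator: the quadratic equation of which [l] is a
    root. *)
Lemma psi_invK : q * ((n%:R + 1) * l + kappa%:R + 2) = l * (l + kappa%:R + 2).
Proof.
have sqrtD : (Num.sqrt D) ^+ 2 = D.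
  by rewrite sqr_sqrtr// (le_trans (sqr_ge0 _) (ltW discr_gt)).
have lB : Num.sqrt D = 2 * l - B.
  by rewrite /l /psi_inv -/B -/D; field.
by move: sqrtD; rewrite lB /D /B; lra.
Qed.

End PsiInv.

(** * Lifting a maximizer of [G], and the fibrewise upper bound *)

Theorem theorem4p14 (R : realType) (G H : sgraph) (n kappa : nat)
    (G_connected : connected G) (G_ge2 : (2 <= #|G|)%N)
    (H_card : #|H| = n) (n_ge1 : (1 <= n)%N)
    (H_regular : regular H kappa)
    (cond_i : ~ ev (adj_mx R H) (- 2 - psi_inv n kappa (QEC R G)))
    (cond_ii : - 2 - minimum (ev (adj_mx R H))
                 <= - ((kappa%:R + 2) / (n%:R + 1))) :
  QEC R (corona G H) = psi_inv n kappa (QEC R G).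
Proof.
have H_gt0 : (0 < #|H|)%N by rewrite H_card.
have [w [w1 sw qw wmax]] := QEC_attained R G_ge2.
have e_gt0 := psi_inv_gt kappa (QEC R G) n_ge1.
have qe := psi_invK kappa (QEC R G) n_ge1.
move: e_gt0 qe qw wmax; move: (psi_inv _ _ _) => l; move: (QEC R G) => q.
set k := kappa%:R; set N : R := n%:R; set e := _ + _ + 2 => e_gt0 qe qw wmax.
have N_gt0 : 0 < N by rewrite ltr0n.
have e0 : e != 0 by rewrite gt_eqF.
have N0 : N != 0 by rewrite gt_eqF.
have qE : q = l * (l + k + 2) / e by rewrite -qe mulfK.
(* With t = (k + 2) / (N + 1), condition (ii) bounds the least eigenvalue below by t - 2, while
   [e > 0] means l > -t. *)
have l_ge : 0 <= l + 2 + minimum (ev (adj_mx R H)).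
  have N1 : 0 < N + 1 by rewrite ltr_wpDr.
  have : 0 < l + (k + 2) / (N + 1).
    rewrite -(pmulr_rgt0 _ N1) (_ : (N + 1) * _ = e)// /e; field.
    by rewrite gt_eqF.
  by move: cond_ii; rewrite -/k -/N; lra.
have sum_const (b : R) : \sum_(h : H) b = N * b.
  by rewrite sumr_const H_card mulr_natl.
(* With [u] the value at [x] and [s] the sum over its copy, these weights solve [u + s = w x] and
   [(l + k + 2) s = N l u], the equality case of [key] below. *)
pose F (a : corona G H) : R := match a with
  | inl x => (l + k + 2) / e * w x | inr (x, _) => l / e * w x end.
have Fw : fibre_sum F = w.
  apply/funext => x; rewrite /fibre_sum /= sum_const.
  by rewrite -[RHS]mul1r -[in RHS](divff e0) /e; ring.
have sF : \sum_a F a = 0 by rewrite big_corona -[RHS]sw -Fw.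
have sqrF : \sum_a F a ^+ 2 = ((l + k + 2) ^+ 2 + N * l ^+ 2) / e ^+ 2.
  transitivity (((l + k + 2) ^+ 2 + N * l ^+ 2) / e ^+ 2 * \sum_x w x ^+ 2).
    rewrite big_corona mulr_sumr; apply: eq_bigr => x _ /=.
    by rewrite sum_const; field.
  by rewrite w1 mulr1.
apply: (@QEC_eq _ _ _ F) => [|||K sK].
- rewrite sqrF mulf_neq0 ?invr_neq0 ?expf_neq0//.
  (* If both squares vanish then [l = 0] and [l + k + 2 = 0], which forces [e = 0]. *)
  apply: contraTneq e_gt0 => z; rewrite -leNgt.
  have := sqr_ge0 (l + k + 2); have := mulr_ge0 (ltW N_gt0) (sqr_ge0 l).
  move=> a b; have /eqP : (l + k + 2) ^+ 2 = 0 by lra.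
  rewrite sqrf_eq0 => /eqP u0; have /eqP : N * l ^+ 2 = 0 by lra.
  rewrite mulf_eq0 (negbTE N0) sqrf_eq0 => /eqP l0.
  by rewrite /e l0; lra.
- exact: sF.
- rewrite dist_form_corona// Fw.
  rewrite qw qE sqrF.
  under eq_bigr do rewrite /F sum_const (adj_form_const H_regular) H_card -/N -/k.
  rewrite (eq_bigr (fun x => (N * (k + 2) * (l / e) ^+ 2) * w x ^+ 2)); last first.
    by move=> x _; ring.
  by rewrite -mulr_sumr w1 mulr1 /e; field.
- rewrite dist_form_corona// big_corona.
  have sKw : \sum_x fibre_sum K x = 0 by rewrite big_corona in sK.
  (* Once the form of [G] is bounded by [q] times the squared norm of the fibre sums, the inequality
     splits over the vertices of [G]. *)
  apply: le_trans (lerB (wmax _ sKw) (lexx _)) _.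
  rewrite !mulr_sumr -sumrB; apply: ler_sum => x _.
  have := adj_form_shift_ge H_regular H_gt0 (fun h => K (inr (x, h))) l_ge.
  rewrite H_card -/k -/N /fibre_sum.
  move: (K (inl x)) (\sum_h K (inr (x, h))) (\sum_h _ ^+ 2) (quad _ _) => u s V A.
  move=> VA.
  have key : q * (u + s) ^+ 2 <= l * u ^+ 2 + (l + 2 + k) * s ^+ 2 / N.
    rewrite -subr_ge0.
    have -> : l * u ^+ 2 + (l + 2 + k) * s ^+ 2 / N - q * (u + s) ^+ 2 =
      ((l + k + 2) * s - N * l * u) ^+ 2 / (N * e).
      by rewrite qE /e; field; rewrite N0 -/e e0.
    by rewrite divr_ge0 ?sqr_ge0// ltW// mulr_gt0.
  by lra.
Qed.
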